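(* Let $k>0$, $b_0\le 0$, $c,m\in\mathbb{R}$, and let $\Phi(t)$ and the velocity field $(u,w)$ be as defined in the context. The vorticity $\gamma:=u_Z-w_X$ of the flow, expressed at the point $(X,Z)=\Phi(t)(a,b)$ in terms of the parameters $(a,b)$, is given by the relation $$\gamma=-\frac{2km\,e^{2kb}}{1-e^{2kb}}\qquad\text{for }b\le b_0.$$
   Context: For $t\ge 0$, $a\in\mathbb{R}$, $b\le b_0$ the particle paths are $$X(t,a,b):=a+(c-m)t-\frac{e^{kb}}{k}\sin(k(a-mt)),\qquad Z(t,a,b):=b+\frac{e^{kb}}{k}\cos(k(a-mt)).$$ Set $\Sigma:=\mathbb{R}\times(-\infty,b_0)$ and $\Phi(t):=(X(t,\cdot,\cdot),Z(t,\cdot,\cdot))$. For each $t\ge0$, $\Phi(t)$ is a real-analytic diffeomorphism of $\Sigma$ onto the fluid domain $\Omega(t):=\Phi(t)(\Sigma)$, and it maps $\partial\Sigma$ bijectively onto $\partial\Omega(t)$. The velocity field is $$u(t,X,Z)=X_t(t,a,b)\big|_{(a,b)=\Phi(t)^{-1}(X,Z)},\qquad w(t,X,Z)=Z_t(t,a,b)\big|_{(a,b)=\Phi(t)^{-1}(X,Z)},$$ for $(X,Z)\in\overline{\Omega(t)}$.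
   Formalization: The point b = b_0 = 0 is excluded by requiring b < 0, since there the denominator 1 − e^{2kb} vanishes and the printed formula is undefined; all other b ≤ b_0 are covered. *)

(* Defs.v *)
From Stdlib Require Import Reals ClassicalEpsilon.
From Coquelicot Require Import Coquelicot.
Open Scope R_scope.

Definition path_X (k c m t a b : R) : R :=
  a + (c - m) * t - exp (k * b) / k * sin (k * (a - m * t)).

Definition path_Z (k m t a b : R) : R :=
  b + exp (k * b) / k * cos (k * (a - m * t)).

Definition Phi (k c m t : R) (p : R * R) : R * R :=
  (path_X k c m t (fst p) (snd p), path_Z k m t (fst p) (snd p)).

Definition Sigma (b0 : R) (p : R * R) : Prop := snd p < b0.

Definition Sigma_closed (b0 : R) (p : R * R) : Prop := snd p <= b0.

Definition Omega (k c m b0 t : R) (P : R * R) : Prop :=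
  exists p : R * R, Sigma b0 p /\ Phi k c m t p = P.

(* Inverse of [Phi k c m t] restricted to the closed half-plane, on which it is
   injective; the value outside the image is irrelevant. *)
Definition Phi_inv (k c m b0 t : R) (P : R * R) : R * R :=
  epsilon (inhabits (0, 0))
    (fun p : R * R => Sigma_closed b0 p /\ Phi k c m t p = P).

Definition velocity_u (k c m b0 t x z : R) : R :=
  let p := Phi_inv k c m b0 t (x, z) in
  Derive (fun s : R => path_X k c m s (fst p) (snd p)) t.

Definition velocity_w (k c m b0 t x z : R) : R :=
  let p := Phi_inv k c m b0 t (x, z) in
  Derive (fun s : R => path_Z k m s (fst p) (snd p)) t.

Definition closure (D : R * R -> Prop) (P : R * R) : Prop :=
  forall eps : posreal, exists Q : R * R, ball P eps Q /\ D Q.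

(* Partial derivatives on the closure of an open set [D]: the usual ones in [D],
   and their continuous extension from [D] at the points of the boundary. *)
Definition is_partial_x (D : R * R -> Prop) (f : R -> R -> R)
    (P : R * R) (l : R) : Prop :=
  (D P /\ is_derive (fun x : R => f x (snd P)) (fst P) l)
  \/
  (closure D P /\ ~ D P /\
   within D (locally P)
     (fun Q : R * R => ex_derive (fun x : R => f x (snd Q)) (fst Q)) /\
   filterlim (fun Q : R * R => Derive (fun x : R => f x (snd Q)) (fst Q))
     (within D (locally P)) (locally l)).

Definition is_partial_z (D : R * R -> Prop) (f : R -> R -> R)
    (P : R * R) (l : R) : Prop :=
  (D P /\ is_derive (fun z : R => f (fst P) z) (snd P) l)
  \/
  (closure D P /\ ~ D P /\
   within D (locally P)
     (fun Q : R * R => ex_derive (fun z : R => f (fst Q) z) (snd Q)) /\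
   filterlim (fun Q : R * R => Derive (fun z : R => f (fst Q) z) (snd Q))
     (within D (locally P)) (locally l)).

Definition is_vorticity (k c m b0 t : R) (P : R * R) (g : R) : Prop :=
  exists uz wx : R,
    is_partial_z (Omega k c m b0 t) (velocity_u k c m b0 t) P uz /\
    is_partial_x (Omega k c m b0 t) (velocity_w k c m b0 t) P wx /\
    g = uz - wx.

(* Main.v *)
Require Import Defs.
From Stdlib Require Import Reals Lra Lia ClassicalEpsilon.
From Coquelicot Require Import Coquelicot.
Open Scope R_scope.

(* Up to a translation, Phi(t) is the identity minus a map that is Lipschitz with
   constant exp (k beta) on the half-plane b <= beta.  For beta < 0 this is a
   contraction, so Phi(t) has a Lipschitz local inverse, whose partial derivatives
   follow from the Jacobian matrix of Phi(t) by Cramer's rule.  The particle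
   velocity is an affine function of (X, Z) and of the displacement of the particle
   from its label:
     u = c - m + m k (Z - b),   w = m k (a + (c - m) t - X),
   hence u_Z - w_X = m k (2 - b_Z - a_X), where b_Z + a_X = 2 / (1 - exp (2 k b)).
   On the boundary the same expressions extend continuously, because the inverse is
   Lipschitz up to b = b0 < 0. *)

(** * Euclidean distance on the plane, identified with [C], and Banach's fixed-point theorem *)

Lemma Cmod_le_fst_snd (z : C) : Cmod z <= Rabs (fst z) + Rabs (snd z).
Proof.
  unfold Cmod. apply Rsqr_incr_0_var.
  - rewrite Rsqr_sqrt by nra. unfold Rsqr.
    pose proof (pow2_abs (fst z)). pose proof (pow2_abs (snd z)).
    pose proof (Rabs_pos (fst z)). pose proof (Rabs_pos (snd z)). nra.
  - pose proof (Rabs_pos (fst z)). pose proof (Rabs_pos (snd z)). lra.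
Qed.

Lemma Cmod_sqr (z : C) : Cmod z ^ 2 = fst z ^ 2 + snd z ^ 2.
Proof. unfold Cmod. apply pow2_sqrt. nra. Qed.

Lemma Cmod_sym (z w : C) : Cmod (z - w) = Cmod (w - z).
Proof. rewrite <- Cmod_opp. f_equal. ring. Qed.

Lemma Cmod_triangle_mid (u v w : C) : Cmod (u - w) <= Cmod (u - v) + Cmod (v - w).
Proof.
  replace (u - w)%C with ((u - v) + (v - w))%C by ring. apply Cmod_triangle.
Qed.

(** The series of increments converges by comparison with a geometric series, and its partial sums
    telescope to [u (S n) - u 0]. *)
Lemma ex_finite_lim_geom_increments (u : nat -> R) (M q : R) :
  0 <= q < 1 -> (forall n, Rabs (u (S n) - u n) <= M * q ^ n) ->
  ex_finite_lim_seq u.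
Proof.
  intros hq hu.
  assert (Hs : ex_series (fun n => u (S n) - u n)).
  { apply (ex_series_le (V := R_CompleteNormedModule) _ (fun n => M * q ^ n)).
    - exact hu.
    - apply (ex_series_scal_l (V := R_NormedModule) M (pow q)), ex_series_geom.
      rewrite Rabs_pos_eq; lra. }
  destruct Hs as [l Hl]. exists (u 0%nat + l).
  apply is_lim_seq_incr_1.
  apply is_lim_seq_ext with (fun n => u 0%nat + sum_n (fun i => u (S i) - u i) n).
  - intros n. induction n as [|n IH].
    + rewrite sum_O. ring.
    + rewrite sum_Sn. unfold plus; simpl. lra.
  - apply (is_lim_seq_plus' _ _ (u 0%nat) l); [apply is_lim_seq_const | exact Hl].
Qed.

(** Picard iteration from 0: successive differences decay like [q ^ n], so both coordinates of the
    iterates converge. *)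
Lemma contraction_fixed_point (T : C -> C) (q : R) :
  0 <= q < 1 -> (forall z w, Cmod (T z - T w) <= q * Cmod (z - w)) ->
  exists z, T z = z.
Proof.
  intros hq hT.
  pose (p := fix p n := match n with O => RtoC 0 | S n => T (p n) end).
  assert (Hp : forall n, Cmod (p (S n) - p n) <= Cmod (p 1%nat - p 0%nat) * q ^ n).
  { induction n as [|n IH].
    - simpl pow. lra.
    - apply Rle_trans with (q * Cmod (p (S n) - p n)); [apply hT|].
      simpl pow. nra. }
  destruct (ex_finite_lim_geom_increments (fun n => fst (p n))
    (Cmod (p 1%nat - p 0%nat)) q hq) as [x Hx].
  { intros n. eapply Rle_trans; [|apply Hp].
    eapply Rle_trans; [|apply Rmax_Cmod]. apply Rmax_l. }
  destruct (ex_finite_lim_geom_increments (fun n => snd (p n))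
    (Cmod (p 1%nat - p 0%nat)) q hq) as [y Hy].
  { intros n. eapply Rle_trans; [|apply Hp].
    eapply Rle_trans; [|apply Rmax_Cmod]. apply Rmax_r. }
  exists (x, y).
  assert (Hlim : is_lim_seq (fun n => Cmod (p n - (x, y))) 0).
  { apply is_lim_seq_le_le with (fun _ => 0)
      (fun n => Rabs (fst (p n) - x) + Rabs (snd (p n) - y)).
    - intros n. split; [apply Cmod_ge_0|]. apply Cmod_le_fst_snd.
    - apply is_lim_seq_const.
    - replace (Finite 0) with (Finite (0 + 0)) by (f_equal; ring).
      apply is_lim_seq_plus'.
      + replace 0 with (Rabs (x - x)) by (rewrite Rminus_diag, Rabs_R0; ring).
        apply (is_lim_seq_abs _ (x - x)), is_lim_seq_minus'; [exact Hx|apply is_lim_seq_const].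
      + replace 0 with (Rabs (y - y)) by (rewrite Rminus_diag, Rabs_R0; ring).
        apply (is_lim_seq_abs _ (y - y)), is_lim_seq_minus'; [exact Hy|apply is_lim_seq_const]. }
  (* The defect is estimated through [p (S n) = T (p n)]; both terms of the resulting bound tend to
     0. *)
  assert (H0 : Cmod (T (x, y) - (x, y)) <= 0).
  { apply (is_lim_seq_le (fun _ => Cmod (T (x, y) - (x, y)))
      (fun n => q * Cmod (p n - (x, y)) + Cmod (p (S n) - (x, y)))
      (Cmod (T (x, y) - (x, y))) 0).
    - intros n. eapply Rle_trans; [apply (Cmod_triangle_mid _ (p (S n)))|].
      apply Rplus_le_compat_r. rewrite (Cmod_sym (p n)). apply hT.
    - apply is_lim_seq_const.
    - replace (Finite 0) with (Finite (q * 0 + 0)) by (f_equal; ring).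
      apply is_lim_seq_plus'.
      + apply (is_lim_seq_scal_l _ q 0), Hlim.
      + apply (is_lim_seq_incr_1 (fun n => Cmod (p n - (x, y)))), Hlim. }
  assert (H1 : (T (x, y) - (x, y))%C = 0).
  { apply Cmod_eq_0. pose proof (Cmod_ge_0 (T (x, y) - (x, y))). lra. }
  replace (T (x, y)) with ((T (x, y) - (x, y)) + (x, y))%C by ring.
  rewrite H1. ring.
Qed.

(** * Elementary inequalities for the exponential and the cosine *)

Lemma exp_lt_1 (x : R) : x < 0 -> exp x < 1.
Proof. intros h. rewrite <- exp_0. now apply exp_increasing. Qed.

(** Strict convexity: the graph of [exp] lies strictly above its tangent at [y]. *)
Lemma exp_sub_lt (x y : R) : x < y -> exp y - exp x < exp y * (y - x).
Proof.
  intros h.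
  assert (H : 1 + (x - y) < exp (x - y)) by (apply exp_ineq1; lra).
  replace (exp x) with (exp y * exp (x - y)) by (rewrite <- exp_plus; f_equal; ring).
  pose proof (exp_pos y). nra.
Qed.

(** The half-angle formula reduces this to [|sin y| <= |y|] at [y = x / 2]. *)
Lemma one_sub_cos_le (x : R) : 2 * (1 - cos x) <= x ^ 2.
Proof.
  replace (cos x) with (cos (2 * (x / 2))) by (f_equal; field).
  rewrite cos_2a_sin.
  assert (H : sin (x / 2) * sin (x / 2) <= x / 2 * (x / 2)); [|nra].
  destruct (Rtotal_order (x / 2) 0) as [h|[h|h]].
  - pose proof (sin_gt_x _ h).
    assert (sin (x / 2) <= - (x / 2)); [|nra].
    (* For [x / 2 <= -1] the bound [sin <= 1] suffices; closer to 0 the sine is negative, since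
       [PI > 1]. *)
    pose proof (SIN_bound (x / 2)). destruct (Rle_dec (x / 2) (- 1)); [lra|].
    assert (- PI < x / 2) by (pose proof PI2_1; lra).
    pose proof (sin_lt_0_var _ H1 h). lra.
  - rewrite h, sin_0. lra.
  - pose proof (sin_lt_x _ h).
    assert (- (x / 2) <= sin (x / 2)); [|nra].
    pose proof (SIN_bound (x / 2)). destruct (Rle_dec 1 (x / 2)); [lra|].
    assert (x / 2 < PI) by (pose proof PI2_1; lra).
    pose proof (sin_gt_0 _ h H1). lra.
Qed.

(** A strict mean value bound: [q] dominates the derivative of [exp] between the two points.
    Squaring makes it symmetric in [x] and [y]. *)
Lemma exp_sub_sqr_lt (x y q : R) :
  x <> y -> exp x <= q -> exp y <= q -> (exp x - exp y) ^ 2 < (q * (x - y)) ^ 2.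
Proof.
  intros hxy hx hy.
  assert (H : forall u v, u < v -> exp v <= q -> (exp v - exp u) ^ 2 < (q * (v - u)) ^ 2).
  { intros u v h hv. pose proof (exp_sub_lt u v h). pose proof (exp_increasing u v h).
    assert (exp v * (v - u) <= q * (v - u)) by nra. nra. }
  destruct (Rtotal_order x y) as [h|[h|h]].
  - replace ((exp x - exp y) ^ 2) with ((exp y - exp x) ^ 2) by ring.
    replace ((q * (x - y)) ^ 2) with ((q * (y - x)) ^ 2) by ring. auto.
  - contradiction.
  - auto.
Qed.

(** The law of cosines, split into a radial and an angular contribution. *)
Lemma polar_dist_sqr (r s x y : R) :
  (r * sin x - s * sin y) ^ 2 + (r * cos x - s * cos y) ^ 2 =
  (r - s) ^ 2 + r * s * (2 * (1 - cos (x - y))).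
Proof.
  rewrite cos_minus.
  pose proof (sin2_cos2 x) as hx. pose proof (sin2_cos2 y) as hy. unfold Rsqr in hx, hy.
  transitivity (r ^ 2 * (sin x * sin x + cos x * cos x) + s ^ 2 * (sin y * sin y + cos y * cos y)
    - 2 * r * s * (cos x * cos y + sin x * sin y)); [ring|].
  rewrite hx, hy. ring.
Qed.

(** * [Phi] as a translation minus a wave: Lipschitz bound, injectivity, local surjectivity *)

Definition drift (c m t : R) : C := ((c - m) * t, 0).

(** In complex notation this is [- (i / k) exp (i k (conj p - m t))], an antiholomorphic map whose
    derivative has modulus [exp (k b)] at depth [b]. *)
Definition wave (k m t : R) (p : C) : C :=
  (exp (k * snd p) / k * sin (k * (fst p - m * t)),
   - (exp (k * snd p) / k * cos (k * (fst p - m * t)))).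

Lemma Phi_wave (k c m t : R) (p : C) :
  Phi k c m t p = (p + drift c m t - wave k m t p)%C.
Proof.
  unfold Phi, path_X, path_Z, drift, wave, Cminus, Copp, Cplus; simpl. f_equal; ring.
Qed.

Lemma wave_dist_sqr (k m t : R) (p1 p2 : C) : 0 < k ->
  (k * Cmod (wave k m t p1 - wave k m t p2)) ^ 2 =
  (exp (k * snd p1) - exp (k * snd p2)) ^ 2 +
  exp (k * snd p1) * exp (k * snd p2) * (2 * (1 - cos (k * (fst p1 - fst p2)))).
Proof.
  intros hk. rewrite Rpow_mult_distr. unfold Cmod. rewrite pow2_sqrt by nra.
  replace (k * (fst p1 - fst p2)) with (k * (fst p1 - m * t) - k * (fst p2 - m * t)) by ring.
  rewrite <- polar_dist_sqr. unfold wave, Cminus, Copp, Cplus; simpl. field. lra.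
Qed.

(** The radial part of the distance is controlled by the difference of depths and the angular part
    by the horizontal separation, each with factor [exp (k beta)]; the two squares add up by
    Pythagoras. *)
Lemma wave_lipschitz (k m t beta : R) (p1 p2 : C) :
  0 < k -> snd p1 <= beta -> snd p2 <= beta ->
  Cmod (wave k m t p1 - wave k m t p2) <= exp (k * beta) * Cmod (p1 - p2).
Proof.
  intros hk h1 h2.
  pose proof (exp_pos (k * beta)) as hq.
  pose proof (Cmod_ge_0 (wave k m t p1 - wave k m t p2)) as hw.
  pose proof (Cmod_ge_0 (p1 - p2)) as hp.
  assert (hE : forall b, b <= beta -> exp (k * b) <= exp (k * beta)).
  { intros b [hb|hb].
    - left. apply exp_increasing. nra.
    - rewrite hb. lra. }
  apply Rmult_le_reg_l with k; [exact hk|].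
  apply Rsqr_incr_0_var; [|apply Rmult_le_pos; [lra|nra]].
  rewrite !Rsqr_pow2, wave_dist_sqr by exact hk.
  replace ((k * (exp (k * beta) * Cmod (p1 - p2))) ^ 2)
    with ((exp (k * beta) * k) ^ 2 * Cmod (p1 - p2) ^ 2) by ring.
  rewrite Cmod_sqr. change (fst (p1 - p2)%C) with (fst p1 - fst p2).
  change (snd (p1 - p2)%C) with (snd p1 - snd p2).
  pose proof (hE _ h1) as hE1. pose proof (hE _ h2) as hE2.
  pose proof (exp_pos (k * snd p1)). pose proof (exp_pos (k * snd p2)).
  assert (hr : (exp (k * snd p1) - exp (k * snd p2)) ^ 2 <=
    (exp (k * beta) * (k * snd p1 - k * snd p2)) ^ 2).
  { destruct (Req_dec (k * snd p1) (k * snd p2)) as [e|e].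
    - rewrite e. apply Req_le. ring.
    - left. now apply exp_sub_sqr_lt. }
  pose proof (one_sub_cos_le (k * (fst p1 - fst p2))) as hc.
  assert (exp (k * snd p1) * exp (k * snd p2) <= exp (k * beta) * exp (k * beta))
    by (apply Rmult_le_compat; lra).
  assert (exp (k * snd p1) * exp (k * snd p2) * (2 * (1 - cos (k * (fst p1 - fst p2)))) <=
    exp (k * beta) * exp (k * beta) * (k * (fst p1 - fst p2)) ^ 2).
  { apply Rmult_le_compat; auto; [nra|].
    pose proof (COS_bound (k * (fst p1 - fst p2))). lra. }
  nra.
Qed.

(* On [snd p <= 0] the constant of [wave_lipschitz] is 1, which does not give
   injectivity; the strictness comes from [exp_sub_sqr_lt] and [snd p1 < 0]. *)
Lemma Phi_inj (k c m t : R) (p1 p2 : C) :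
  0 < k -> snd p1 < 0 -> snd p2 <= 0 ->
  Phi k c m t p1 = Phi k c m t p2 -> p1 = p2.
Proof.
  intros hk h1 h2 he. rewrite !Phi_wave in he.
  (* Equal images force the wave to preserve the separation of the two points, which contradicts
     strict contraction unless they coincide. *)
  assert (hw : (wave k m t p1 - wave k m t p2)%C = (p1 - p2)%C).
  { replace (wave k m t p1) with
      (p1 + drift c m t - (p1 + drift c m t - wave k m t p1))%C by ring.
    rewrite he. ring. }
  pose proof (wave_dist_sqr k m t p1 p2 hk) as hd.
  rewrite hw, Rpow_mult_distr, Cmod_sqr in hd.
  change (fst (p1 - p2)%C) with (fst p1 - fst p2) in hd.
  change (snd (p1 - p2)%C) with (snd p1 - snd p2) in hd.
  assert (hE1 : exp (k * snd p1) < 1) by (apply exp_lt_1; nra).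
  assert (hE2 : exp (k * snd p2) <= 1).
  { destruct h2 as [h2|h2].
    - left. rewrite <- exp_0. apply exp_increasing. nra.
    - rewrite h2, Rmult_0_r, exp_0. lra. }
  pose proof (exp_pos (k * snd p1)). pose proof (exp_pos (k * snd p2)).
  pose proof (one_sub_cos_le (k * (fst p1 - fst p2))) as hc.
  pose proof (COS_bound (k * (fst p1 - fst p2))).
  assert (hEE : exp (k * snd p1) * exp (k * snd p2) <= exp (k * snd p1)) by nra.
  set (G := 2 * (1 - cos (k * (fst p1 - fst p2)))) in *.
  assert (hG : exp (k * snd p1) * exp (k * snd p2) * G <=
    exp (k * snd p1) * (k * (fst p1 - fst p2)) ^ 2).
  { apply Rmult_le_compat; auto; [nra | unfold G; lra]. }
  pose proof (pow2_ge_0 (k * (fst p1 - fst p2))) as hsq.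
  destruct (Req_dec (snd p1) (snd p2)) as [e|e].
  (* At equal depths the radial part vanishes, and the factor [exp (k * snd p1) < 1] forces the
     horizontal separation to be 0. *)
  - rewrite e, Rminus_diag in hd.
    assert ((k * (fst p1 - fst p2)) ^ 2 <= 0) by (rewrite <- e in *; nra).
    assert (k * (fst p1 - fst p2) = 0) by nra.
    assert (fst p1 = fst p2) by nra.
    now apply injective_projections.
  - assert (he' : k * snd p1 <> k * snd p2) by (intros e'; apply e; nra).
    pose proof (exp_sub_sqr_lt _ _ 1 he' (Rlt_le _ _ hE1) hE2).
    nra.
Qed.

(** Reverse triangle inequality. For [beta < 0] it yields a Lipschitz bound for the inverse, up to
    and including depth [beta]. *)
Lemma Phi_expanding (k c m t beta : R) (p1 p2 : C) :
  0 < k -> snd p1 <= beta -> snd p2 <= beta ->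
  (1 - exp (k * beta)) * Cmod (p1 - p2) <= Cmod (Phi k c m t p1 - Phi k c m t p2).
Proof.
  intros hk h1 h2. rewrite !Phi_wave.
  pose proof (wave_lipschitz k m t beta p1 p2 hk h1 h2) as hw.
  assert (Cmod (p1 - p2) <= Cmod (p1 + drift c m t - wave k m t p1 - (p2 + drift c m t - wave k m t p2))
    + Cmod (wave k m t p1 - wave k m t p2)); [|lra].
  eapply Rle_trans; [|apply Cmod_triangle]. apply Req_le. f_equal. ring.
Qed.

(* Truncating the depth at [beta] turns the fixed-point equation for the preimage
   into a global contraction; near [Phi p0] the truncation is inactive. *)
Lemma Phi_local_surj (k c m t beta : R) (p0 : C) :
  0 < k -> beta < 0 -> snd p0 < beta ->
  exists delta, 0 < delta /\ forall Q : C, Cmod (Q - Phi k c m t p0) < delta ->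
    exists p : C, snd p < beta /\ Phi k c m t p = Q :> C.
Proof.
  intros hk hbeta h0. set (q := exp (k * beta)).
  assert (hq : 0 < q < 1).
  { split; [apply exp_pos|]. unfold q. rewrite <- exp_0. apply exp_increasing. nra. }
  (* The fixed point lies within [Cmod (Q - Phi k c m t p0) / (1 - q)] of [p0]; this radius keeps it
     above no point of depth [beta], so its depth stays below [beta]. *)
  exists ((1 - q) * (beta - snd p0)). split; [nra|]. intros Q hQ.
  pose (cut := fun p : C => (fst p, Rmin (snd p) beta) : C).
  (* Projection onto a half-plane does not increase distances. *)
  assert (hcut : forall p1 p2, Cmod (cut p1 - cut p2) <= Cmod (p1 - p2)).
  { intros p1 p2. apply Rsqr_incr_0_var; [|apply Cmod_ge_0].
    rewrite !Rsqr_pow2, !Cmod_sqr.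
    change (fst (p1 - p2)%C) with (fst p1 - fst p2).
    change (snd (p1 - p2)%C) with (snd p1 - snd p2).
    change (fst (cut p1 - cut p2)%C) with (fst p1 - fst p2).
    change (snd (cut p1 - cut p2)%C) with (Rmin (snd p1) beta - Rmin (snd p2) beta).
    apply Rplus_le_compat_l.
    destruct (Rle_lt_dec (snd p1) beta) as [h1|h1], (Rle_lt_dec (snd p2) beta) as [h2|h2].
    - rewrite !Rmin_left by lra. lra.
    - rewrite Rmin_left, Rmin_right by lra. nra.
    - rewrite Rmin_right, Rmin_left by lra. nra.
    - rewrite !Rmin_right, Rminus_diag, pow_i by (lra || lia). apply pow2_ge_0. }
  pose (T := fun p => (Q - drift c m t + wave k m t (cut p))%C).
  assert (hT : forall p1 p2, Cmod (wave k m t (cut p1) - wave k m t (cut p2)) <= q * Cmod (p1 - p2)).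
  { intros p1 p2. eapply Rle_trans; [apply (wave_lipschitz _ _ _ beta); [exact hk|apply Rmin_r..]|].
    apply Rmult_le_compat_l; [lra|apply hcut]. }
  destruct (contraction_fixed_point T q) as [p hp]; [lra| |].
  { intros p1 p2. eapply Rle_trans; [|apply hT]. apply Req_le. unfold T. f_equal. ring. }
  assert (hcut0 : cut p0 = p0).
  { unfold cut. rewrite Rmin_left by lra. now destruct p0. }
  assert (hd : Cmod (p - p0) <= Cmod (Q - Phi k c m t p0) + q * Cmod (p - p0)).
  { eapply Rle_trans; [|apply Rplus_le_compat_l, hT].
    eapply Rle_trans; [|apply Cmod_triangle]. apply Req_le. f_equal.
    rewrite hcut0, Phi_wave. rewrite <- hp at 1. unfold T. ring. }
  assert (hs : snd p < beta).
  { assert (Cmod (p - p0) < beta - snd p0) by nra.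
    pose proof (Rmax_Cmod (p - p0)%C) as hm.
    pose proof (Rmax_r (Rabs (fst (p - p0)%C)) (Rabs (snd (p - p0)%C))) as hr.
    pose proof (Rle_abs (snd (p - p0)%C)) as ha.
    change (snd (p - p0)%C) with (snd p - snd p0) in *. lra. }
  exists p. split; [exact hs|]. rewrite Phi_wave.
  assert (hcutp : cut p = p).
  { unfold cut. rewrite Rmin_left by lra. now destruct p. }
  rewrite <- hp at 1. unfold T. rewrite hcutp. ring.
Qed.

(** * The inverse of [Phi] and its local Lipschitz bound *)

Lemma Phi_inv_Phi (k c m b0 t : R) (p : C) :
  0 < k -> b0 <= 0 -> snd p <= b0 -> snd p < 0 ->
  Phi_inv k c m b0 t (Phi k c m t p) = p.
Proof.
  intros hk hb0 hp hp0.
  assert (h : exists p' : R * R, Sigma_closed b0 p' /\ Phi k c m t p' = Phi k c m t p)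
    by (exists p; now split).
  destruct (epsilon_spec (inhabits (0, 0)) _ h) as [hs he].
  (* The point chosen by [epsilon] might a priori have depth 0; [Phi_inj] asks for strict negativity
     of one point only, here [p]. *)
  symmetry. apply (Phi_inj k c m t); auto. unfold Sigma_closed in hs.
  eapply Rle_trans; [exact hs|exact hb0].
Qed.

Lemma Phi_inv_Omega (k c m b0 t : R) (Q : C) :
  0 < k -> b0 <= 0 -> Omega k c m b0 t Q ->
  Sigma b0 (Phi_inv k c m b0 t Q) /\ Phi k c m t (Phi_inv k c m b0 t Q) = Q.
Proof.
  intros hk hb0 [p [hp hQ]]. unfold Sigma in hp. subst Q.
  rewrite Phi_inv_Phi by (auto; lra). now split.
Qed.

Lemma path_Phi_inv (k c m b0 t x z : R) :
  0 < k -> b0 <= 0 -> Omega k c m b0 t (x, z) ->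
  let p := Phi_inv k c m b0 t (x, z) in
  path_X k c m t (fst p) (snd p) = x /\ path_Z k m t (fst p) (snd p) = z.
Proof.
  intros hk hb0 hO. apply Phi_inv_Omega in hO as [_ h]; auto.
  injection h as hX hZ. now split.
Qed.

(** Local surjectivity makes [Omega] open, and the expansion estimate bounds the inverse. *)
Lemma Phi_inv_locally_lipschitz (k c m b0 t : R) (p0 : C) :
  0 < k -> b0 <= 0 -> Sigma b0 p0 ->
  exists delta L, 0 < delta /\ 0 < L /\
    forall Q : C, Cmod (Q - Phi k c m t p0) < delta ->
      Omega k c m b0 t Q /\
      Cmod (Phi_inv k c m b0 t Q - p0) <= L * Cmod (Q - Phi k c m t p0).
Proof.
  (* The intermediate depth [beta] is strictly negative even when [b0 = 0], so [1 - exp (k * beta)]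
     is positive. *)
  unfold Sigma. intros hk hb0 h0. set (beta := (snd p0 + b0) / 2).
  assert (hbeta : snd p0 < beta < b0) by (unfold beta; lra).
  assert (hq : exp (k * beta) < 1) by (apply exp_lt_1; nra).
  destruct (Phi_local_surj k c m t beta p0) as [delta [hdelta hd]]; [auto|lra..|].
  exists delta, (/ (1 - exp (k * beta))). split; [auto|].
  split; [apply Rinv_0_lt_compat; lra|].
  intros Q hQ. destruct (hd Q hQ) as [p [hp <-]].
  split; [exists p; split; [unfold Sigma; lra|reflexivity]|].
  rewrite Phi_inv_Phi by (auto; lra).
  apply Rmult_le_reg_l with (1 - exp (k * beta)); [lra|].
  rewrite <- Rmult_assoc, Rinv_r, Rmult_1_l by lra.
  apply Phi_expanding; auto; lra.
Qed.

(** * Implicit differentiation and the partial derivatives of the inverse *)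

(* Cramer's rule for [fa da + fb db = F' ds], [ga da + gb db = G' ds]. *)
Lemma is_derive_implicit_fst (f g : R -> R -> R) (fa fb ga gb F' G' L s0 : R) (al be : R -> R) :
  0 < L -> fa * gb - fb * ga <> 0 ->
  differentiable_pt_lim f (al s0) (be s0) fa fb ->
  differentiable_pt_lim g (al s0) (be s0) ga gb ->
  locally s0 (fun s => Rabs (al s - al s0) <= L * Rabs (s - s0)) ->
  locally s0 (fun s => Rabs (be s - be s0) <= L * Rabs (s - s0)) ->
  locally s0 (fun s => f (al s) (be s) - f (al s0) (be s0) = F' * (s - s0)) ->
  locally s0 (fun s => g (al s) (be s) - g (al s0) (be s0) = G' * (s - s0)) ->
  is_derive al s0 ((gb * F' - fb * G') / (fa * gb - fb * ga)).
Proof.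
  intros hL hJ hf hg hal hbe hF hG.
  set (J := fa * gb - fb * ga) in *.
  set (K := Rabs gb + Rabs fb + 1).
  pose proof (Rabs_pos gb). pose proof (Rabs_pos fb).
  assert (hK : 0 < K) by (unfold K; lra).
  assert (hJ' : 0 < Rabs J) by now apply Rabs_pos_lt.
  split; [apply is_linear_scal_l|].
  intros x hx. rewrite <- (is_filter_lim_locally_unique (V := R_NormedModule) _ _ hx). intros eps.
  (* This tolerance for the linearization errors absorbs the Lipschitz constant [L], the
     coefficients bounded by [K], and the division by [J]. *)
  assert (heps : 0 < eps * Rabs J / (L * K)).
  { apply Rdiv_lt_0_compat; [|nra]. apply Rmult_lt_0_compat; [apply cond_pos|auto]. }
  destruct (hf (mkposreal _ heps)) as [df hdf]. destruct (hg (mkposreal _ heps)) as [dg hdg].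
  assert (hnear : forall d : posreal, locally s0 (fun s => L * Rabs (s - s0) < d)).
  { intros d. assert (hd : 0 < d / L) by (apply Rdiv_lt_0_compat; [apply cond_pos|auto]).
    exists (mkposreal _ hd). intros s hs. change (Rabs (s - s0) < d / L) in hs.
    apply (Rmult_lt_compat_l L) in hs; auto. replace (L * (d / L)) with (pos d) in hs by (field; lra).
    exact hs. }
  generalize (filter_and _ _ (hnear df) (filter_and _ _ (hnear dg) (filter_and _ _ hal
    (filter_and _ _ hbe (filter_and _ _ hF hG))))).
  apply filter_imp. intros s (nf & ng & ha & hb & eF & eG).
  change (Rabs (al s - al s0 - (s - s0) * ((gb * F' - fb * G') / J)) <= eps * Rabs (s - s0)).
  specialize (hdf (al s) (be s) ltac:(lra) ltac:(lra)).
  specialize (hdg (al s) (be s) ltac:(lra) ltac:(lra)).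
  simpl in hdf, hdg.
  set (M := Rmax (Rabs (al s - al s0)) (Rabs (be s - be s0))) in *.
  assert (hM : M <= L * Rabs (s - s0)) by (apply Rmax_lub; auto).
  rewrite eF in hdf. rewrite eG in hdg.
  (* Eliminating the increment of [be] between the two remainders leaves [(fb * rg - gb * rf) / J]
     as the error for [al]. *)
  set (rf := F' * (s - s0) - (fa * (al s - al s0) + fb * (be s - be s0))) in *.
  set (rg := G' * (s - s0) - (ga * (al s - al s0) + gb * (be s - be s0))) in *.
  replace (al s - al s0 - (s - s0) * ((gb * F' - fb * G') / J))
    with ((fb * rg - gb * rf) / J) by (unfold rf, rg; unfold J in hJ |- *; field; exact hJ).
  rewrite Rabs_div by exact hJ.
  apply Rmult_le_reg_l with (Rabs J); auto.
  replace (Rabs J * (Rabs (fb * rg - gb * rf) / Rabs J)) with (Rabs (fb * rg - gb * rf)) by (field; lra).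
  eapply Rle_trans; [apply Rabs_triang|]. rewrite Rabs_Ropp, !Rabs_mult.
  set (e := eps * Rabs J / (L * K)) in *.
  assert (heM : e * M <= e * (L * Rabs (s - s0))) by (apply Rmult_le_compat_l; lra).
  apply Rle_trans with (K * (e * (L * Rabs (s - s0)))).
  - assert (0 <= e * (L * Rabs (s - s0))) by (pose proof (Rabs_pos rf); lra).
    assert (Rabs fb * Rabs rg <= Rabs fb * (e * (L * Rabs (s - s0))))
      by (apply Rmult_le_compat_l; lra).
    assert (Rabs gb * Rabs rf <= Rabs gb * (e * (L * Rabs (s - s0))))
      by (apply Rmult_le_compat_l; lra).
    unfold K. nra.
  - apply Req_le. unfold e. field. lra.
Qed.

(** Exchanging the variables lets [is_derive_implicit_fst] deliver the second unknown too. *)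
Lemma differentiable_pt_lim_swap (f : R -> R -> R) (x y lx ly : R) :
  differentiable_pt_lim f x y lx ly ->
  differentiable_pt_lim (fun v u => f u v) y x ly lx.
Proof.
  intros h eps. destruct (h eps) as [d hd]. exists d. intros v u hv hu.
  specialize (hd u v hu hv). rewrite Rmax_comm.
  replace (ly * (v - y) + lx * (u - x)) with (lx * (u - x) + ly * (v - y)) by ring.
  exact hd.
Qed.

Lemma path_X_differentiable (k c m t a b : R) : 0 < k ->
  differentiable_pt_lim (path_X k c m t) a b
    (1 - exp (k * b) * cos (k * (a - m * t))) (- (exp (k * b) * sin (k * (a - m * t)))).
Proof.
  intros hk. apply filterdiff_differentiable_pt_lim.
  (* Total differentiability follows from continuity of one partial derivative, here the one in [a],
     and existence of the other at the point. *)
  apply (is_derive_filterdiff (path_X k c m t) a b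
    (fun x y => 1 - exp (k * y) * cos (k * (x - m * t)))).
  - apply filter_forall. intros [x y]. simpl. unfold path_X. auto_derive; [auto|unfold Rminus; field; lra].
  - unfold path_X. auto_derive; [auto|unfold Rminus; field; lra].
  - apply (continuity_2d_pt_filterlim (fun x y => 1 - exp (k * y) * cos (k * (x - m * t)))).
    apply continuity_2d_pt_minus; [apply continuity_2d_pt_const|].
    apply continuity_2d_pt_mult; apply continuity_1d_2d_pt_comp.
    + apply derivable_continuous_pt, derivable_pt_exp.
    + apply continuity_2d_pt_mult; [apply continuity_2d_pt_const|apply continuity_2d_pt_id2].
    + apply continuity_cos.
    + apply continuity_2d_pt_mult; [apply continuity_2d_pt_const|].
      apply continuity_2d_pt_minus; [apply continuity_2d_pt_id1|apply continuity_2d_pt_const].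
Qed.

Lemma path_Z_differentiable (k m t a b : R) : 0 < k ->
  differentiable_pt_lim (path_Z k m t) a b
    (- (exp (k * b) * sin (k * (a - m * t)))) (1 + exp (k * b) * cos (k * (a - m * t))).
Proof.
  intros hk. apply filterdiff_differentiable_pt_lim.
  apply (is_derive_filterdiff (path_Z k m t) a b
    (fun x y => - (exp (k * y) * sin (k * (x - m * t))))).
  - apply filter_forall. intros [x y]. simpl. unfold path_Z. auto_derive; [auto|unfold Rminus; field; lra].
  - unfold path_Z. auto_derive; [auto|unfold Rminus; field; lra].
  - apply (continuity_2d_pt_filterlim (fun x y => - (exp (k * y) * sin (k * (x - m * t))))).
    apply continuity_2d_pt_opp.
    apply continuity_2d_pt_mult; apply continuity_1d_2d_pt_comp.
    + apply derivable_continuous_pt, derivable_pt_exp.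
    + apply continuity_2d_pt_mult; [apply continuity_2d_pt_const|apply continuity_2d_pt_id2].
    + apply continuity_sin.
    + apply continuity_2d_pt_mult; [apply continuity_2d_pt_const|].
      apply continuity_2d_pt_minus; [apply continuity_2d_pt_id1|apply continuity_2d_pt_const].
Qed.

(* The entries a_X and b_Z of the inverse of the Jacobian matrix of Phi(t). *)
Definition label_a_X (k m t : R) (p : R * R) : R :=
  (1 + exp (k * snd p) * cos (k * (fst p - m * t))) / (1 - exp (k * snd p) ^ 2).

Definition label_b_Z (k m t : R) (p : R * R) : R :=
  (1 - exp (k * snd p) * cos (k * (fst p - m * t))) / (1 - exp (k * snd p) ^ 2).

(** Applied to horizontal and vertical lines, this supplies the a priori Lipschitz bounds required
    by [is_derive_implicit_fst]. *)
Lemma Phi_inv_curve (k c m b0 t : R) (p0 : C) (gamma : R -> C) (s0 : R) :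
  0 < k -> b0 <= 0 -> Sigma b0 p0 -> gamma s0 = Phi k c m t p0 ->
  (forall s, Cmod (gamma s - gamma s0) <= Rabs (s - s0)) ->
  exists L, 0 < L /\
    locally s0 (fun s => Omega k c m b0 t (gamma s) /\
      Cmod (Phi_inv k c m b0 t (gamma s) - p0) <= L * Rabs (s - s0)).
Proof.
  intros hk hb0 hp h0 hg.
  destruct (Phi_inv_locally_lipschitz k c m b0 t p0 hk hb0 hp)
    as (delta & L & hdelta & hL & H).
  exists L. split; [exact hL|]. exists (mkposreal _ hdelta). intros s hs.
  change (Rabs (s - s0) < delta) in hs. specialize (hg s). rewrite h0 in hg.
  destruct (H (gamma s)) as [hO hl]; [lra|]. split; [exact hO|].
  eapply Rle_trans; [exact hl|]. apply Rmult_le_compat_l; lra.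
Qed.

Lemma is_derive_Phi_inv (k c m b0 t : R) (p0 : C) :
  0 < k -> b0 <= 0 -> Sigma b0 p0 ->
  let P0 := Phi k c m t p0 in
  is_derive (fun x => fst (Phi_inv k c m b0 t (x, snd P0))) (fst P0) (label_a_X k m t p0) /\
  is_derive (fun z => snd (Phi_inv k c m b0 t (fst P0, z))) (snd P0) (label_b_Z k m t p0).
Proof.
  intros hk hb0 hp P0. assert (hp' : snd p0 < b0) by exact hp.
  assert (hinv : Phi_inv k c m b0 t (fst P0, snd P0) = p0).
  { rewrite <- surjective_pairing. apply Phi_inv_Phi; auto; lra. }
  pose proof (exp_pos (k * snd p0)) as hE0.
  assert (hE : exp (k * snd p0) < 1) by (apply exp_lt_1; nra).
  set (th := k * (fst p0 - m * t)).
  pose proof (sin2_cos2 th) as hsc. unfold Rsqr in hsc.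
  assert (hfst : forall z w : C, Rabs (fst z - fst w) <= Cmod (z - w)).
  { intros z w. eapply Rle_trans; [|apply Rmax_Cmod]. apply Rmax_l. }
  assert (hsnd : forall z w : C, Rabs (snd z - snd w) <= Cmod (z - w)).
  { intros z w. eapply Rle_trans; [|apply Rmax_Cmod]. apply Rmax_r. }
  pose proof (path_X_differentiable k c m t (fst p0) (snd p0) hk) as dX.
  pose proof (path_Z_differentiable k m t (fst p0) (snd p0) hk) as dZ.
  fold th in dX, dZ. set (e := exp (k * snd p0)) in *.
  (* The Jacobian determinant of [Phi], nonzero because [e < 1]. *)
  assert (hJ : (1 - e * cos th) * (1 + e * cos th) -
    - (e * sin th) * - (e * sin th) = 1 - e ^ 2).
  { transitivity (1 - e ^ 2 * (sin th * sin th + cos th * cos th)); [ring|].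
    rewrite hsc. ring. }
  split.
  - destruct (Phi_inv_curve k c m b0 t p0 (fun x => (x, snd P0)) (fst P0))
      as (L & hL & H); auto.
    { intros s. eapply Rle_trans; [apply Cmod_le_fst_snd|]. simpl.
      rewrite Rplus_opp_r, Rabs_R0. unfold Rminus. lra. }
    replace (label_a_X k m t p0) with (((1 + e * cos th) * 1 - - (e * sin th) * 0) /
      ((1 - e * cos th) * (1 + e * cos th) - - (e * sin th) * - (e * sin th)))
      by (rewrite hJ; unfold label_a_X; fold th e; f_equal; ring).
    apply (is_derive_implicit_fst (path_X k c m t) (path_Z k m t) _ _ _ _ _ _ L _
      (fun x : R => fst (Phi_inv k c m b0 t (x, snd P0)))
      (fun x : R => snd (Phi_inv k c m b0 t (x, snd P0)))); auto.
    + rewrite hJ. nra.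
    + rewrite hinv. exact dX.
    + rewrite hinv. exact dZ.
    + revert H. apply filter_imp. intros s [_ hs]. rewrite hinv.
      eapply Rle_trans; [apply hfst|exact hs].
    + revert H. apply filter_imp. intros s [_ hs]. rewrite hinv.
      eapply Rle_trans; [apply hsnd|exact hs].
    + revert H. apply filter_imp. intros s [hs _].
      apply path_Phi_inv in hs as [hX hZ]; auto.
      rewrite hinv, hX. change (path_X k c m t (fst p0) (snd p0)) with (fst P0). ring.
    + revert H. apply filter_imp. intros s [hs _].
      apply path_Phi_inv in hs as [hX hZ]; auto.
      rewrite hinv, hZ. change (path_Z k m t (fst p0) (snd p0)) with (snd P0). ring.
  - destruct (Phi_inv_curve k c m b0 t p0 (fun z => (fst P0, z)) (snd P0))
      as (L & hL & H); auto.
    { intros s. eapply Rle_trans; [apply Cmod_le_fst_snd|]. simpl.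
      rewrite Rplus_opp_r, Rabs_R0. unfold Rminus. lra. }
    assert (hJ' : (1 + e * cos th) * (1 - e * cos th) -
      - (e * sin th) * - (e * sin th) = 1 - e ^ 2) by (rewrite <- hJ; ring).
    replace (label_b_Z k m t p0) with (((1 - e * cos th) * 1 - - (e * sin th) * 0) /
      ((1 + e * cos th) * (1 - e * cos th) - - (e * sin th) * - (e * sin th)))
      by (rewrite hJ'; unfold label_b_Z; fold th e; f_equal; ring).
    (* Equations and unknowns are both exchanged: along a vertical line the [Z] equation comes
       first, with [b] as first unknown. *)
    apply (is_derive_implicit_fst (fun v u => path_Z k m t u v) (fun v u => path_X k c m t u v)
      _ _ _ _ _ _ L _
      (fun z : R => snd (Phi_inv k c m b0 t (fst P0, z)))
      (fun z : R => fst (Phi_inv k c m b0 t (fst P0, z)))); auto.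
    + rewrite hJ'. nra.
    + rewrite hinv. apply differentiable_pt_lim_swap, dZ.
    + rewrite hinv. apply differentiable_pt_lim_swap, dX.
    + revert H. apply filter_imp. intros s [_ hs]. rewrite hinv.
      eapply Rle_trans; [apply hsnd|exact hs].
    + revert H. apply filter_imp. intros s [_ hs]. rewrite hinv.
      eapply Rle_trans; [apply hfst|exact hs].
    + revert H. apply filter_imp. intros s [hs _].
      apply path_Phi_inv in hs as [hX hZ]; auto.
      rewrite hinv, hZ. change (path_Z k m t (fst p0) (snd p0)) with (snd P0). ring.
    + revert H. apply filter_imp. intros s [hs _].
      apply path_Phi_inv in hs as [hX hZ]; auto.
      rewrite hinv, hX. change (path_X k c m t (fst p0) (snd p0)) with (fst P0). ring.
Qed.

(** * The velocity gradient and the vorticity in the interior *)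

(* The oscillating terms in the particle velocity are [m k] times the
   displacements of the particle from its label. *)
Lemma velocity_Omega (k c m b0 t x z : R) :
  0 < k -> b0 <= 0 -> Omega k c m b0 t (x, z) ->
  velocity_u k c m b0 t x z = c - m + m * k * (z - snd (Phi_inv k c m b0 t (x, z))) /\
  velocity_w k c m b0 t x z =
    m * k * (fst (Phi_inv k c m b0 t (x, z)) + (c - m) * t - x).
Proof.
  intros hk hb0 hO. apply path_Phi_inv in hO as [hX hZ]; auto.
  unfold velocity_u, velocity_w. set (p := Phi_inv k c m b0 t (x, z)) in *.
  split; apply is_derive_unique.
  - rewrite <- hZ. unfold path_X, path_Z. auto_derive; [auto|unfold Rminus; field; lra].
  - rewrite <- hX. unfold path_X, path_Z. auto_derive; [auto|unfold Rminus; field; lra].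
Qed.

Lemma is_derive_velocity (k c m b0 t : R) (Q : R * R) :
  0 < k -> b0 <= 0 -> Omega k c m b0 t Q ->
  is_derive (fun z => velocity_u k c m b0 t (fst Q) z) (snd Q)
    (m * k * (1 - label_b_Z k m t (Phi_inv k c m b0 t Q))) /\
  is_derive (fun x => velocity_w k c m b0 t x (snd Q)) (fst Q)
    (m * k * (label_a_X k m t (Phi_inv k c m b0 t Q) - 1)).
Proof.
  intros hk hb0 hO. destruct (Phi_inv_Omega k c m b0 t Q hk hb0 hO) as [hp hQ].
  destruct (is_derive_Phi_inv k c m b0 t _ hk hb0 hp) as [hx hz].
  rewrite hQ in hx, hz. set (p := Phi_inv k c m b0 t Q) in *.
  assert (hu : forall (f : R -> R) s l, is_derive f s l ->
    is_derive (fun z => c - m + m * k * (z - f z)) s (m * k * (1 - l))).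
  { intros f s l h. auto_derive; [now exists l|].
    replace l with (Derive (fun y : R => f y) s) by exact (is_derive_unique _ _ _ h). ring. }
  assert (hw : forall (f : R -> R) s l, is_derive f s l ->
    is_derive (fun x => m * k * (f x + (c - m) * t - x)) s (m * k * (l - 1))).
  { intros f s l h. auto_derive; [now exists l|].
    replace l with (Derive (fun y : R => f y) s) by exact (is_derive_unique _ _ _ h). ring. }
  split.
  - destruct (Phi_inv_curve k c m b0 t p (fun z => (fst Q, z)) (snd Q))
      as (L & hL & H); auto.
    { now rewrite hQ, <- surjective_pairing. }
    { intros s. eapply Rle_trans; [apply Cmod_le_fst_snd|]. simpl.
      rewrite Rplus_opp_r, Rabs_R0. unfold Rminus. lra. }
    (* The formula for the velocity holds only in [Omega], which contains a whole segment of the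
       line around this point. *)
    apply is_derive_ext_loc with
      (fun z : R => c - m + m * k * (z - snd (Phi_inv k c m b0 t (fst Q, z)))).
    + revert H. apply filter_imp. intros s [hs _]. symmetry.
      apply velocity_Omega; auto.
    + apply (hu _ _ _ hz).
  - destruct (Phi_inv_curve k c m b0 t p (fun x => (x, snd Q)) (fst Q))
      as (L & hL & H); auto.
    { now rewrite hQ, <- surjective_pairing. }
    { intros s. eapply Rle_trans; [apply Cmod_le_fst_snd|]. simpl.
      rewrite Rplus_opp_r, Rabs_R0. unfold Rminus. lra. }
    apply is_derive_ext_loc with
      (fun x : R => m * k * (fst (Phi_inv k c m b0 t (x, snd Q)) + (c - m) * t - x)).
    + revert H. apply filter_imp. intros s [hs _]. symmetry.
      apply velocity_Omega; auto.
    + apply (hw _ _ _ hx).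
Qed.

(** The cosines cancel in [a_X + b_Z], and [2 - 2 / (1 - E) = - 2 E / (1 - E)] with
    [E = exp (2 k b)]. *)
Lemma vorticity_identity (k m t : R) (p : R * R) : 0 < k -> snd p < 0 ->
  - (2 * k * m * exp (2 * k * snd p)) / (1 - exp (2 * k * snd p)) =
  m * k * (1 - label_b_Z k m t p) - m * k * (label_a_X k m t p - 1).
Proof.
  intros hk hp. unfold label_b_Z, label_a_X.
  pose proof (exp_pos (k * snd p)).
  assert (exp (k * snd p) < 1) by (apply exp_lt_1; nra).
  replace (exp (2 * k * snd p)) with (exp (k * snd p) ^ 2).
  - field. nra.
  - replace (2 * k * snd p) with (k * snd p + k * snd p) by ring.
    rewrite exp_plus. ring.
Qed.

(** * Boundary points, and the vorticity formula on the closed domain *)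

Lemma boundary_not_Omega (k c m b0 t : R) (p : C) :
  0 < k -> snd p = b0 -> b0 < 0 -> ~ Omega k c m b0 t (Phi k c m t p).
Proof.
  intros hk hp hb0 [p' [hp' he]]. unfold Sigma in hp'.
  apply Phi_inj in he; [|lra..]. subst p'. lra.
Qed.

Lemma boundary_closure_Omega (k c m b0 t : R) (p : C) :
  0 < k -> snd p = b0 -> b0 < 0 -> closure (Omega k c m b0 t) (Phi k c m t p).
Proof.
  (* On this half-plane [Phi] is Lipschitz with constant [1 + exp (k * b0) < 2], so lowering the
     label by [eps / 4] moves the image by at most [eps / 2]. *)
  intros hk hp hb0 eps. set (p' := (fst p, b0 - eps / 4) : C).
  pose proof (cond_pos eps) as heps.
  exists (Phi k c m t p'). split; [|exists p'; split; [unfold Sigma, p'; simpl; lra|reflexivity]].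
  apply C_NormedModule_mixin_compat1.
  change (minus (Phi k c m t p') (Phi k c m t p)) with (Phi k c m t p' - Phi k c m t p)%C.
  assert (hd : Cmod (p' - p) <= eps / 4).
  { eapply Rle_trans; [apply Cmod_le_fst_snd|]. unfold p'. simpl.
    rewrite hp, Rplus_opp_r, Rabs_R0, Rabs_left by lra. lra. }
  assert (hw := wave_lipschitz k m t b0 p' p hk ltac:(unfold p'; simpl; lra) ltac:(lra)).
  assert (exp (k * b0) < 1) by (apply exp_lt_1; nra).
  pose proof (exp_pos (k * b0)). pose proof (Cmod_ge_0 (p' - p)).
  apply Rle_lt_trans with (Cmod (p' - p) + Cmod (wave k m t p - wave k m t p')).
  - rewrite !Phi_wave. eapply Rle_trans; [|apply Cmod_triangle].
    apply Req_le. f_equal. ring.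
  - rewrite (Cmod_sym (wave k m t p)). nra.
Qed.

Lemma Phi_inv_boundary_limit (k c m b0 t : R) (p : C) :
  0 < k -> snd p = b0 -> b0 < 0 ->
  filterlim (Phi_inv k c m b0 t)
    (within (Omega k c m b0 t) (locally (Phi k c m t p))) (locally (p : R * R)).
Proof.
  intros hk hp hb0. apply filterlim_locally. intros eps.
  assert (hq : exp (k * b0) < 1) by (apply exp_lt_1; nra).
  (* The factor 1/2 is there because the product ball bounds each coordinate, while the modulus is
     bounded by their sum. *)
  assert (hd : 0 < (1 - exp (k * b0)) * eps / 2).
  { pose proof (cond_pos eps). nra. }
  exists (mkposreal _ hd). intros Q hQ hO.
  destruct (Phi_inv_Omega k c m b0 t Q hk (Rlt_le _ _ hb0) hO) as [hs he].
  unfold Sigma in hs. apply C_NormedModule_mixin_compat1.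
  change (minus (Phi_inv k c m b0 t Q) p) with (Phi_inv k c m b0 t Q - p)%C.
  pose proof (Phi_expanding k c m t b0 (Phi_inv k c m b0 t Q) p hk ltac:(lra) ltac:(lra)) as hx.
  rewrite he in hx.
  assert (hQ' : Cmod (Q - Phi k c m t p) < (1 - exp (k * b0)) * eps).
  { destruct hQ as [h1 h2].
    change (Rabs (fst Q - fst (Phi k c m t p)) < (1 - exp (k * b0)) * eps / 2) in h1.
    change (Rabs (snd Q - snd (Phi k c m t p)) < (1 - exp (k * b0)) * eps / 2) in h2.
    eapply Rle_lt_trans; [apply Cmod_le_fst_snd|].
    change (fst (Q - Phi k c m t p)%C) with (fst Q - fst (Phi k c m t p)).
    change (snd (Q - Phi k c m t p)%C) with (snd Q - snd (Phi k c m t p)). lra. }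
  apply Rmult_lt_reg_l with (1 - exp (k * b0)); lra.
Qed.

Lemma inv_Jacobian_continuous (k m t : R) (p : R * R) : 0 < k -> snd p < 0 ->
  continuous (label_b_Z k m t) p /\ continuous (label_a_X k m t) p.
Proof.
  intros hk hp.
  pose proof (exp_pos (k * snd p)).
  assert (exp (k * snd p) < 1) by (apply exp_lt_1; nra).
  assert (hE : continuous (fun p : R * R => exp (k * snd p)) p).
  { apply (continuous_comp (fun p : R * R => snd p) (fun b => exp (k * b))).
    - apply continuous_snd.
    - apply (ex_derive_continuous (fun b => exp (k * b))). auto_derive. auto. }
  assert (hC : continuous (fun p : R * R => cos (k * (fst p - m * t))) p).
  { apply (continuous_comp (fun p : R * R => fst p) (fun a => cos (k * (a - m * t)))).
    - apply continuous_fst.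
    - apply (ex_derive_continuous (fun a => cos (k * (a - m * t)))). auto_derive. auto. }
  assert (hJ : continuous (fun p : R * R => / (1 - exp (k * snd p) ^ 2)) p).
  { apply (continuous_comp (fun p : R * R => exp (k * snd p)) (fun e => / (1 - e ^ 2))).
    - exact hE.
    - apply (ex_derive_continuous (fun e => / (1 - e ^ 2))). auto_derive. nra. }
  pose proof (continuous_mult (K := R_AbsRing) _ _ _ hE hC) as hEC.
  split; apply (continuous_mult (K := R_AbsRing)); auto.
  - apply (continuous_minus (V := R_NormedModule)); [apply continuous_const|exact hEC].
  - apply (continuous_plus (V := R_NormedModule)); [apply continuous_const|exact hEC].
Qed.

(* When b0 = 0 the Jacobian 1 - exp (2 k b) of Phi, which is the denominator of
   the formula, vanishes at b = 0; the hypothesis b < 0 excludes only that case. *)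
Theorem lemma3p6 (k b0 c m : R) (hk : 0 < k) (hb0 : b0 <= 0)
    (t a b : R) (ht : 0 <= t) (hb : b <= b0) (hb_neg : b < 0) :
  is_vorticity k c m b0 t (Phi k c m t (a, b))
    (- (2 * k * m * exp (2 * k * b)) / (1 - exp (2 * k * b))).
Proof.
  set (p := (a, b) : C).
  exists (m * k * (1 - label_b_Z k m t p)), (m * k * (label_a_X k m t p - 1)).
  split; [|split]; [..|exact (vorticity_identity k m t p hk hb_neg)].
  - destruct hb as [hb|hb].
    + assert (hO : Omega k c m b0 t (Phi k c m t p)) by now exists p.
      left. split; [exact hO|].
      destruct (is_derive_velocity k c m b0 t _ hk hb0 hO) as [hd _].
      rewrite Phi_inv_Phi in hd by (auto; simpl; lra). exact hd.
    (* On the boundary [b0 < 0], and the interior derivative is a continuous function of the label,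
       which converges to [p]. *)
    + rewrite hb in hb_neg. right. split; [now apply boundary_closure_Omega|].
      split; [now apply boundary_not_Omega|]. split.
      * unfold within. apply filter_forall. intros Q hO. eexists. now apply is_derive_velocity.
      * apply filterlim_within_ext
          with (fun Q => m * k * (1 - label_b_Z k m t (Phi_inv k c m b0 t Q))).
        { intros Q hO. symmetry. apply is_derive_unique. now apply is_derive_velocity. }
        apply (filterlim_comp _ _ _ (Phi_inv k c m b0 t)
          (fun q => m * k * (1 - label_b_Z k m t q)) _ (locally (p : R * R))).
        { now apply Phi_inv_boundary_limit. }
        apply (continuous_comp (label_b_Z k m t) (fun y => m * k * (1 - y))).
        { apply inv_Jacobian_continuous; [auto|simpl; lra]. }
        apply (ex_derive_continuous (fun y => m * k * (1 - y))). auto_derive. auto.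
  - destruct hb as [hb|hb].
    + assert (hO : Omega k c m b0 t (Phi k c m t p)) by now exists p.
      left. split; [exact hO|].
      destruct (is_derive_velocity k c m b0 t _ hk hb0 hO) as [_ hd].
      rewrite Phi_inv_Phi in hd by (auto; simpl; lra). exact hd.
    + rewrite hb in hb_neg. right. split; [now apply boundary_closure_Omega|].
      split; [now apply boundary_not_Omega|]. split.
      * unfold within. apply filter_forall. intros Q hO. eexists. now apply is_derive_velocity.
      * apply filterlim_within_ext
          with (fun Q => m * k * (label_a_X k m t (Phi_inv k c m b0 t Q) - 1)).
        { intros Q hO. symmetry. apply is_derive_unique. now apply is_derive_velocity. }
        apply (filterlim_comp _ _ _ (Phi_inv k c m b0 t)
          (fun q => m * k * (label_a_X k m t q - 1)) _ (locally (p : R * R))).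
        { now apply Phi_inv_boundary_limit. }
        apply (continuous_comp (label_a_X k m t) (fun y => m * k * (y - 1))).
        { apply inv_Jacobian_continuous; [auto|simpl; lra]. }
        apply (ex_derive_continuous (fun y => m * k * (y - 1))). auto_derive. auto.
Qed.
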